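(* Let $n \geq 4$ be an even integer and let $\widetilde{L}$ be the special Laplacian of the wheel graph $W_n$. Then every cofactor of $\widetilde{L}$ is equal to $2^{n-3}$.
   Context: For $c=(c_1,\dotsc,c_m)$, $\mathrm{Circ}(c)$ denotes the $m\times m$ circulant matrix whose $(i,j)$ entry is $c_{((j-i) \bmod m)+1}$. Special Laplacian: for $n\ge4$ even and $k\in\{1,\dotsc,\frac n2-1\}$, let $c^k\in\mathbb{R}^{n-1}$ have $c^k_j=1$ if $j=k+1$ or $j=n-k$ and $c^k_j=0$ otherwise, and let $C_k=\mathrm{Circ}(c^k)$ (of order $n-1$). Then \[\widetilde{L} := \frac{n-1}{2} I - \frac12\begin{bmatrix}0 & \mathbf{1}'\\ \mathbf{1} & 0\end{bmatrix} + \sum_{k=1}^{\frac n2 -1} (-1)^k \frac{(n-1)-2k}{2}\begin{bmatrix}0&0\\0&C_k\end{bmatrix},\] an $n\times n$ matrix, where $\mathbf{1}$ is the all-ones vector of length $n-1$. The $(i,j)$ cofactor of an $n\times n$ matrix $A$ is $(-1)^{i+j}$ times the determinant of the submatrix obtained by deleting row $i$ and column $j$. *)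

(* Defs.v *)
From mathcomp Require Import all_boot all_order all_algebra.

Set Implicit Arguments.
Unset Strict Implicit.
Unset Printing Implicit Defensive.

Import GRing.Theory Num.Theory.
Local Open Scope ring_scope.

(* (j - i) mod m; as i < m, the truncated subtraction below is exact. *)
Definition circ_idx (m : nat) (i j : 'I_m) : 'I_m :=
  Ordinal (ltn_pmod (j + m - i)%N (leq_ltn_trans (leq0n i) (ltn_ord i))).

Definition Circ (R : Type) (m : nat) (c : 'rV[R]_m) : 'M[R]_m :=
  \matrix_(i, j) c 0 (circ_idx i j).

(* Ordinals are 0-based: the component at j : 'I_(n-1) is the (j+1)-st one. *)
Definition cvec (R : realFieldType) (n k : nat) : 'rV[R]_(n.-1) :=
  \row_j ((j.+1 == k.+1) || (j.+1 == n - k)%N)%:R.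

Definition Cmat (R : realFieldType) (n k : nat) : 'M[R]_(n.-1) :=
  Circ (cvec R n k).

(* The order 1 + (n - 1) is n for n > 0; it displays the block structure. *)
Definition Ltilde (R : realFieldType) (n : nat) : 'M[R]_(1 + n.-1) :=
  ((n%:R - 1) / 2) *: 1%:M
  - 2^-1 *: block_mx 0 (const_mx 1) (const_mx 1) 0
  + \sum_(1 <= k < n./2)
      ((-1) ^+ k * ((n%:R - 1 - 2 * k%:R) / 2)) *: block_mx 0 0 0 (Cmat R n k).

(* Main.v *)
Require Import Defs.
From mathcomp Require Import all_boot all_order all_algebra.
From mathcomp Require Import ring lra zify.

(* Write m = n - 1, which is odd. Then Ltilde is symmetric with zero row sums,
   and its lower right block is the circulant matrix B with first row
   b_d = (-1)^d (m - 2d) / 2. If S is the cyclic shift of order m, then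
   b_d + b_(d+1) = (-1)^d for all d modulo m, whence (1 + S)^2 B = 2 S. The
   characteristic polynomial of S is X^m - 1, so det (1 + S) = 2 and det S = 1,
   and det B = 2^(m-2). As B is invertible, the kernel of Ltilde is spanned by
   the all-ones vector; since Ltilde annihilates its adjugate on both sides,
   the adjugate is constant, equal to its (0,0) entry det B. *)

Set Implicit Arguments.
Unset Strict Implicit.
Unset Printing Implicit Defensive.

Import GRing.Theory Num.Theory.
Local Open Scope ring_scope.

(** * Cofactors of matrices with zero row and column sums *)

(** Subtracting [v 0 0] times the all-ones vector leaves a kernel vector with zero head; its tail is
    then killed by the invertible block [drsubmx L]. *)
Lemma ker_const_mx (F : fieldType) (m : nat) (L : 'M[F]_(1 + m))
    (v : 'cV[F]_(1 + m)) :
  L *m const_mx 1 = 0 :> 'cV_(1 + m) -> \det (drsubmx L) != 0 ->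
  L *m v = 0 -> v = const_mx (v 0 0).
Proof.
move=> L1 dL Lv; pose w := v - v 0 0 *: const_mx 1.
have Lw : L *m w = 0 by rewrite mulmxBr -scalemxAr Lv L1 scaler0 subr0.
suff w0 : w = 0.
  by rewrite -[LHS](subrK (v 0 0 *: const_mx 1)) -/w w0 add0r
             scalemx_const mulr1.
have uw : usubmx w = 0.
  apply/colP=> i; rewrite !mxE ord1 (_ : lshift m 0 = 0); last exact: val_inj.
  by rewrite mulr1 subrr.
move: Lw; rewrite -[w]vsubmxK -[L in L *m _]submxK mul_block_col uw !mulmx0 !add0r.
rewrite -[0 in X in X -> _]vsubmxK => /eq_col_mx[_].
rewrite linear0 => Lw.
have unitL : drsubmx L \in unitmx by rewrite unitmxE unitfE.
by rewrite -[dsubmx w](mulKmx unitL) Lw mulmx0 col_mx0.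
Qed.

Lemma cofactor00 (R : comNzRingType) (m : nat) (L : 'M[R]_(1 + m)) :
  cofactor L 0 0 = \det (drsubmx L).
Proof.
rewrite /cofactor addn0 expr0 mul1r; congr (\det _).
by apply/matrixP=> i j; rewrite !mxE; congr (L _ _); apply: val_inj.
Qed.

Lemma cofactor_zero_sums (F : fieldType) (m : nat) (L : 'M[F]_(1 + m)) :
  L *m const_mx 1 = 0 :> 'cV_(1 + m) -> const_mx 1 *m L = 0 :> 'rV_(1 + m) ->
  \det (drsubmx L) != 0 ->
  forall i j, cofactor L i j = \det (drsubmx L).
Proof.
move=> L1 L1' dL i j.
have dL0 : \det L = 0.
  have [/eqP //|nz] := boolP (\det L == 0).
  have uL : L \in unitmx by rewrite unitmxE unitfE.
  have /matrixP/(_ 0 0) := mulKmx uL (const_mx 1 : 'cV_(1 + m)).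
  by rewrite L1 mulmx0 !mxE => /eqP; rewrite eq_sym oner_eq0.
have Ladj : L *m \adj L = 0 by rewrite mul_mx_adj dL0 raddf0.
have adjL : L^T *m (\adj L)^T = 0 by rewrite -trmx_mul mul_adj_mx dL0 raddf0 trmx0.
have c1 k l : \adj L k l = \adj L 0 l.
  have Lc : L *m col l (\adj L) = 0 by rewrite colE mulmxA Ladj mul0mx.
  by have /matrixP/(_ k 0) := ker_const_mx L1 dL Lc; rewrite !mxE.
(* The rows of the adjugate lie in the kernel of [L^T]. *)
have c2 k l : \adj L k l = \adj L k 0.
  have Lc : L^T *m col k (\adj L)^T = 0 by rewrite colE mulmxA adjL mul0mx.
  have L1T : L^T *m const_mx 1 = 0 :> 'cV_(1 + m).
    by rewrite -[const_mx 1]trmxK -trmx_mul trmx_const L1' trmx0.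
  have dLT : \det (drsubmx L^T) != 0 by rewrite -trmx_drsub det_tr.
  by have /matrixP/(_ l 0) := ker_const_mx L1T dLT Lc; rewrite !mxE.
by rewrite -cofactor00; have := c1 j i; rewrite (c2 0 i) !mxE.
Qed.

(** * The cyclic shift and its characteristic polynomial *)

(** With order [m.+2], the indices form a ring, so [i + 1] is already taken modulo the order. *)
Definition cshift (R : nzRingType) (m : nat) : 'M[R]_m.+2 :=
  \matrix_(i, j) (j == i + 1)%:R.

Lemma val_addS1 (m : nat) (i : 'I_m.+2) :
  (i + 1 : 'I_m.+2) = (if i == m.+1 :> nat then 0 else i.+1)%N :> nat.
Proof.
rewrite /= [(1 %% _)%N]modn_small // addn1; case: ifPn => [/eqP->|ne].
  by rewrite modnn.
by rewrite modn_small //; have := ltn_ord i; lia.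
Qed.

Lemma eq_addS1 (m : nat) (i j : 'I_m.+2) :
  (j == i + 1) = (j == (if i == m.+1 :> nat then 0 else i.+1)%N :> nat).
Proof. by rewrite -val_addS1. Qed.

Lemma addS1_eq0 (m : nat) (i : 'I_m.+2) : (i + 1 == 0) = (i == m.+1 :> nat).
Proof.
have -> : (i + 1 == 0) = ((i + 1 : 'I_m.+2) == 0%N :> nat) by [].
by rewrite val_addS1; case: ifP.
Qed.

Lemma cshift_companion (R : nzRingType) (m : nat) (p : {poly R})
    (e : (size p).-1 = m.+2) :
  p = 'X^(m.+2) - 1 -> castmx (e, e) (companionmx p) = cshift R m.
Proof.
move=> pE; apply/matrixP=> i j; rewrite castmxE !mxE eq_addS1 /= e /=.
rewrite pE !coefE.
(* The leading coefficient never occurs as [j < m.+2], so the last companion row has its only 1 at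
   column 0: the wrap-around of the shift. *)
rewrite (ltn_eqF (ltn_ord j)) sub0r opprK.
by case: (i == m.+1 :> nat) => //; rewrite eq_sym.
Qed.

Lemma char_poly_cshift (R : comNzRingType) (m : nat) :
  char_poly (cshift R m) = 'X^(m.+2) - 1.
Proof.
have sp : (size ('X^(m.+2) - 1 : {poly R})).-1 = m.+2 by rewrite size_XnsubC.
rewrite -(cshift_companion sp erefl).
have cast_char k k' (e : k = k') (A : 'M[R]_k) :
    char_poly (castmx (e, e) A) = char_poly A.
  by case: _ / e; rewrite castmx_id.
by rewrite cast_char companionmxK // monicXnsubC.
Qed.

(** Evaluate the characteristic polynomial at [- a] and pull the sign out of the determinant. *)
Lemma det_addM_cshift (R : comNzRingType) (m : nat) (a : R) :
  \det (a%:M + cshift R m) = a ^+ m.+2 - (-1) ^+ m.+2.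
Proof.
have := congr1 (horner^~ (- a)) (char_poly_cshift R m).
rewrite /char_poly -horner_evalE -det_map_mx.
have -> : map_mx (horner_eval (- a)) (char_poly_mx (cshift R m)) = - (a%:M + cshift R m).
  apply/matrixP=> i j; rewrite !mxE /horner_eval hornerD hornerN hornerC hornerMn hornerX.
  by rewrite opprD mulNrn.
rewrite -scaleN1r detZ !hornerE => E.
by rewrite -[LHS](signrMK m.+2) E mulrBr mulr1 (exprNn a) signrMK.
Qed.

Lemma mul_cshift (R : nzRingType) (m n : nat) (A : 'M[R]_(m.+2, n))
    (i : 'I_m.+2) (j : 'I_n) :
  (cshift R m *m A) i j = A (i + 1) j.
Proof.
rewrite mxE (bigD1 (i + 1)) //= big1 ?addr0 ?mxE ?eqxx ?mul1r // => k.
by rewrite mxE => /negbTE ->; rewrite mul0r.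
Qed.

(** * The circulant block: determinant and row sums *)

Definition altc (R : realFieldType) (m x : nat) : R :=
  (-1) ^+ x * (m%:R - 2 * x%:R) / 2.

Definition altrow (R : realFieldType) (m : nat) : 'rV[R]_m := \row_x altc R m x.

(** Parity matters only at the wrap-around [x = m.+1], whose successor is 0. *)
Lemma altcD (R : realFieldType) (m : nat) (x : 'I_m.+2) : ~~ odd m.+1 ->
  altc R m.+2 x + altc R m.+2 (x + 1 : 'I_m.+2)%R = (-1) ^+ x.
Proof.
move=> om; rewrite val_addS1 /altc; case: eqP => [->|_].
  by rewrite -signr_odd (negbTE om) expr0; field.
by rewrite exprS -[x.+1%:R]natr1; field.
Qed.

Lemma circ_idxE (m : nat) (i j : 'I_m.+2) : circ_idx i j = j - i.
Proof. by apply: val_inj => /=; rewrite modnDmr addnBA // ltnW. Qed.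

(** Each factor adds to a row its cyclic successor. The first turns the entries into alternating
    signs; under the second, neighbouring signs cancel except at the wrap-around, where both are
    1. *)
Lemma cshift_sqr_Circ (R : realFieldType) (m : nat) : ~~ odd m.+1 ->
  (1%:M + cshift R m) *m ((1%:M + cshift R m) *m Circ (altrow R m.+2)) =
  2 *: cshift R m.
Proof.
move=> om; have D1 (A : 'M[R]_m.+2) i j :
    ((1%:M + cshift R m) *m A) i j = A i j + A (i + 1) j.
  by rewrite mulmxDl mul1mx mxE mul_cshift.
have D2 i j : ((1%:M + cshift R m) *m Circ (altrow R m.+2)) i j =
    (-1) ^+ (j - (i + 1) : 'I_m.+2)%R.
  rewrite D1 !mxE !circ_idxE -(altcD R (j - (i + 1)) om).
  have -> : j - (i + 1) + 1 = j - i by rewrite opprD addrA subrK.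
  exact: addrC.
apply/matrixP=> i j; rewrite D1 !D2 !mxE -[j == _]subr_eq0.
have -> : j - (i + 1) = j - (i + 1 + 1) + 1 by rewrite [in RHS]opprD addrA subrK.
move: (j - _) => y.
rewrite addS1_eq0 val_addS1.
case: eqP => [->|_] /=.
  by rewrite -[(-1) ^+ m.+1]signr_odd (negbTE om) !expr0; ring.
by rewrite exprS; ring.
Qed.

Lemma det_Circ_alt (R : realFieldType) (m : nat) : ~~ odd m.+1 ->
  \det (Circ (altrow R m.+2)) = 2 ^+ m.
Proof.
move=> om; have := congr1 determinant (cshift_sqr_Circ R om).
(* The case [a = 0] gives the determinant of the shift itself. *)
have := det_addM_cshift m (0 : R); rewrite raddf0 add0r.
rewrite !det_mulmx det_addM_cshift detZ => ->.
rewrite expr1n expr0n sub0r exprS -signr_odd (negbTE om) expr0 !exprS => E.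
lra.
Qed.

(** Each further pair of terms contributes -1. Keeping [a] independent of [h] lets the induction go
    through. *)
Lemma sum_altc (R : realFieldType) (a : R) (h : nat) :
  \sum_(x < h.*2.+1) (-1) ^+ x * (a - 2 * x%:R) / 2 = a / 2 - h%:R.
Proof.
elim: h => [|h IH]; first by rewrite big_ord1 /=; field.
rewrite doubleS 2!big_ord_recr /= IH -signr_odd -[in X in _ + X]signr_odd.
by rewrite /= odd_double expr0 expr1 -!natr1 -muln2 natrM; field.
Qed.

Lemma sum_altrow (R : realFieldType) (h : nat) :
  \sum_x altrow R h.+1.*2.+1 0 x = 2^-1.
Proof.
under eq_bigr do rewrite mxE.
by rewrite sum_altc -natr1 -muln2 natrM; field.
Qed.

(** * Block form of the special Laplacian *)

Lemma doubleS_sub1 (R : nzRingType) (h : nat) :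
  h.+1.*2%:R - 1 = h.*2.+1%:R :> R.
Proof. by rewrite doubleS -[_.+2%:R]natr1 addrK. Qed.

(* As n - 1 is odd, the coefficient (-1)^k (n - 1 - 2k) / 2 is invariant under
   k -> n - 1 - k, so altc describes both nonzero diagonals of each C_k. *)
Lemma sum_Cmat (R : realFieldType) (h : nat) (i j : 'I_h.+1.*2.+1) :
  \sum_(1 <= k < h.+2)
    (-1) ^+ k * ((h.+2.*2%:R - 1 - 2 * k%:R) / 2) * Cmat R h.+2.*2 k i j =
  Circ (altrow R h.+1.*2.+1) i j - (h.+2.*2%:R - 1) / 2 * (i == j)%:R.
Proof.
rewrite [Circ _ i j]mxE; under eq_bigr do rewrite !mxE.
rewrite [altrow _ _ _ _]mxE.
have -> : (i == j) = (circ_idx i j == 0).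
  by rewrite circ_idxE subr_eq0 eq_sym.
move: (circ_idx i j) => x; have ltx := ltn_ord x.
rewrite doubleS_sub1.
have [->|xn0] := eqVneq x 0.
  rewrite big_nat big1 => [|k /andP[k0 kh]].
    by rewrite /altc /= expr0; field.
  by rewrite (_ : _ || _ = false) ?mulr0 //=; apply/negbTE; lia.
have x0 : (0 < x)%N by rewrite lt0n; apply: contra xn0.
rewrite mulr0 subr0.
(* Exactly one [k] contributes: [x] itself in the lower half, [h.+1.*2.+1 - x] in the upper half. *)
have [xh|xh] := leqP x h.+1.
  rewrite (bigD1_seq (val x)) ?iota_uniq ?mem_index_iota ?x0 //=.
  rewrite eqxx big_nat_cond big1 => [|k /andP[/andP[k0 kh] kx]].
    by rewrite /altc /=; field.
  by rewrite (_ : _ || _ = false) ?mulr0 //=; apply/negbTE; lia.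
rewrite (bigD1_seq (h.+1.*2.+1 - x)%N) ?iota_uniq ?mem_index_iota //=; last by lia.
rewrite big_nat_cond big1 => [|k /andP[/andP[k0 kh] kx]]; last first.
  by rewrite (_ : _ || _ = false) ?mulr0 //=; apply/negbTE; lia.
rewrite (_ : _ || _ = true) /=; last by lia.
rewrite /altc natrB 1?ltnW // -signr_odd oddB 1?ltnW //= odd_double /=.
by rewrite -[in RHS]signr_odd; case: (odd x) => /=; rewrite ?expr0 ?expr1; field.
Qed.

Lemma Ltilde_block (R : realFieldType) (h : nat) :
  Ltilde R h.+2.*2 =
  block_mx ((h.+2.*2%:R - 1) / 2)%:M (const_mx (- 2^-1))
           (const_mx (- 2^-1)) (Circ (altrow R h.+1.*2.+1)).
Proof.
rewrite /Ltilde.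
have -> : h.+2.*2./2 = h.+2 by rewrite doubleK.
rewrite scalar_mx_block.
under eq_bigr do rewrite scale_block_mx !scaler0.
have sumE (r : seq nat) (F : nat -> 'M[R]_(h.+1.*2.+1)) :
    \sum_(k <- r) block_mx (0 : 'M_1) 0 0 (F k) = block_mx 0 0 0 (\sum_(k <- r) F k).
  elim: r => [|a r IH]; first by rewrite !big_nil block_mx0.
  by rewrite !big_cons IH add_block_mx !addr0.
rewrite sumE !scale_block_mx opp_block_mx !add_block_mx.
congr block_mx.
- by apply/matrixP=> i j; rewrite !mxE; ring.
- by apply/matrixP=> i j; rewrite !mxE; ring.
- by apply/matrixP=> i j; rewrite !mxE; ring.
apply/matrixP=> i j; rewrite 3!mxE summxE; under eq_bigr do rewrite mxE.
by rewrite sum_Cmat !mxE; ring.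
Qed.

Lemma Circ_mul_const (R : nzRingType) (m : nat) (c : 'rV[R]_m.+2) :
  Circ c *m const_mx 1 = const_mx (\sum_x c 0 x) :> 'cV_m.+2.
Proof.
apply/matrixP=> i j; rewrite !mxE [RHS](reindex_inj (addIr (- i))) /=.
by apply: eq_bigr => k _; rewrite !mxE mulr1 circ_idxE.
Qed.

Lemma const_mul_Circ (R : nzRingType) (m : nat) (c : 'rV[R]_m.+2) :
  const_mx 1 *m Circ c = const_mx (\sum_x c 0 x) :> 'rV_m.+2.
Proof.
apply/matrixP=> i j; rewrite !mxE [RHS](reindex_inj (subrI j)) /=.
by apply: eq_bigr => k _; rewrite !mxE mul1r circ_idxE.
Qed.

Theorem theorem4 (R : realFieldType) (n : nat) (hn : (4 <= n)%N)
    (neven : ~~ odd n) (i j : 'I_(1 + n.-1)) :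
  cofactor (Ltilde R n) i j = 2 ^+ (n - 3).
Proof.
(* In this form [n - 1] reduces to [(h.*2.+1).+2], as the lemmas on circulants require. *)
have [h nE] : exists h, n = h.+2.*2 by exists (n./2 - 2)%N; lia.
subst n.
have dE : \det (drsubmx (Ltilde R h.+2.*2)) = 2 ^+ (h.+2.*2 - 3).
  rewrite Ltilde_block block_mxKdr det_Circ_alt; last by rewrite /= odd_double.
  by congr (_ ^+ _); lia.
rewrite cofactor_zero_sums ?dE ?expf_neq0 ?pnatr_eq0 // Ltilde_block.
(* The head gives (n - 1)/2 - (n - 1)/2, every other row -1/2 + 1/2. *)
- rewrite -[const_mx 1](@col_mx_const _ 1 h.+1.*2.+1 1) mul_block_col Circ_mul_const.
  rewrite sum_altrow -(@col_mx0 _ 1 h.+1.*2.+1 1); congr col_mx; apply/matrixP=> k l.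
    rewrite mul_scalar_mx !mxE; under eq_bigr do rewrite !mxE mulr1.
    by rewrite doubleS_sub1 sumr_const card_ord -[- 2^-1 *+ _]mulr_natr /=; field.
  by rewrite !mxE big_ord1 !mxE mulr1 addNr.
- rewrite -[const_mx 1](@row_mx_const _ 1 1 h.+1.*2.+1) mul_row_block const_mul_Circ.
  rewrite sum_altrow -(@row_mx0 _ 1 1 h.+1.*2.+1); congr row_mx; apply/matrixP=> k l.
    rewrite mul_mx_scalar !mxE; under eq_bigr do rewrite !mxE mul1r.
    by rewrite doubleS_sub1 sumr_const card_ord -[- 2^-1 *+ _]mulr_natr /=; field.
  by rewrite !mxE big_ord1 !mxE mul1r addNr.
Qed.
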